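(* Let $(\xi^n)_{n\ge1}$ be a sequence of Lévy processes and let $T_n\ge0$ be random times (with $T_n$ defined on the same probability space as $\xi^n$, and not assumed independent of $\xi^n$) such that $T_n\to1$ in probability. If $\xi^n_{T_n}\overset{d}{\to}Z$ for some random variable $Z$, then $\xi^n_1\overset{d}{\to}Z$.
   Context: Lévy processes are real-valued, càdlàg, indexed by $[0,\infty)$ and started at $0$. $\overset{d}{\to}$ denotes convergence in distribution as $n\to\infty$. *)

(* Defs.v *)
From HB Require Import structures.
From mathcomp Require Import all_boot all_order all_algebra.
From mathcomp Require Import all_classical all_reals all_analysis.
From mathcomp Require Import measurable_realfun.

Set Implicit Arguments.
Unset Strict Implicit.
Unset Printing Implicit Defensive.

Import Order.TTheory GRing.Theory Num.Theory.
Import numFieldNormedType.Exports.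

Local Open Scope classical_set_scope.
Local Open Scope ring_scope.

(* Paths on [0, +oo[ are represented by functions on R whose values at negative
   times are irrelevant: no condition below involves them. *)
Definition cadlag (R : realType) (x : R -> R) : Prop :=
  (forall t, 0 <= t -> x s @[s --> t^'+] --> x t) /\
  (forall t, 0 < t -> cvg (x s @[s --> t^'-])).

Definition mutually_independent (R : realType) (d : measure_display)
    (T : measurableType d) (P : probability T R) (I : finType)
    (X : I -> {RV P >-> R}) : Prop :=
  forall (J : {set I}) (B : I -> set R), (forall i, measurable (B i)) ->
    P (\bigcap_(i in [set` J]) (X i @^-1` B i)) =
    (\prod_(i in J) P (X i @^-1` B i))%E.
Arguments mutually_independent {R d T} P {I} X.

Definition eq_distribution (R : realType) (d d' : measure_display)
    (T : measurableType d) (T' : measurableType d')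
    (P : probability T R) (P' : probability T' R)
    (X : {RV P >-> R}) (Y : {RV P' >-> R}) : Prop :=
  forall B : set R, measurable B -> distribution P X B = distribution P' Y B.
Arguments eq_distribution {R d d' T T'} P P' X Y.

Definition increment (R : realType) (d : measure_display)
    (T : measurableType d) (P : probability T R)
    (X : R -> {RV P >-> R}) (s t : R) (w : T) : R := X t w - X s w.

Lemma measurable_increment (R : realType) (d : measure_display)
    (T : measurableType d) (P : probability T R)
    (X : R -> {RV P >-> R}) (s t : R) :
  measurable_fun [set: T] (increment X s t).
Proof. by apply: measurable_funB; exact: measurable_funPT. Qed.

HB.instance Definition _ (R : realType) (d : measure_display)
    (T : measurableType d) (P : probability T R)
    (X : R -> {RV P >-> R}) (s t : R) :=
  isMeasurableFun.Build _ _ _ _ (increment X s t) (measurable_increment X s t).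

Record levy_process (R : realType) (d : measure_display)
    (T : measurableType d) (P : probability T R) := LevyProcess {
  levy_val :> R -> {RV P >-> R} ;
  levy_start0 : forall w, levy_val 0 w = 0 ;
  levy_cadlag : forall w, cadlag (fun t => levy_val t w) ;
  levy_stationary : forall s t, 0 <= s -> s <= t ->
    eq_distribution P P (increment levy_val s t) (levy_val (t - s)) ;
  levy_independent : forall (k : nat) (t : nat -> R), 0 <= t 0%N ->
    (forall i, (i < k)%N -> t i <= t i.+1) ->
    mutually_independent P
      (fun i : 'I_k => increment levy_val (t i) (t i.+1))
}.

Record random_time (R : realType) (d : measure_display)
    (T : measurableType d) (P : probability T R) := RandomTime {
  time_val :> {mfun T >-> R} ;
  time_ge0 : forall w, 0 <= time_val w
}.

Lemma measurable_sample (R : realType) (d : measure_display)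
    (T : measurableType d) (P : probability T R)
    (X : levy_process P) (tau : random_time P) :
  measurable_fun [set: T] (fun w => X (tau w) w).
Proof.
pose r (k : nat) (w : T) : R := (Num.trunc (k.+1%:R * tau w)).+1%:R / k.+1%:R.
have rgt k w : tau w < r k w.
  rewrite /r ltr_pdivlMr ?ltr0n// mulrC.
  have h : 0 <= k.+1%:R * tau w by rewrite mulr_ge0// time_ge0.
  by have /andP[] := truncn_itv h.
have rle k w : r k w <= tau w + k.+1%:R^-1.
  rewrite /r -natr1 mulrDl mul1r lerD2r ler_pdivrMr ?ltr0n// [leRHS]mulrC.
  have h : 0 <= k.+1%:R * tau w by rewrite mulr_ge0// time_ge0.
  by have /andP[] := truncn_itv h.
apply: (@measurable_fun_cvg _ _ _ _ (fun k w => X (r k w) w)).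
- move=> k _ B mB; rewrite setTI.
  rewrite (_ : _ @^-1` B = \bigcup_(j : nat)
    ((fun w => Num.trunc (k.+1%:R * tau w)) @^-1` [set j] `&`
      (X (j.+1%:R / k.+1%:R) @^-1` B))); last first.
    apply/seteqP; split => [w /= Bw|w [j _ [/= <- //]]].
    by exists (Num.trunc (k.+1%:R * tau w)).
  apply: bigcup_measurable => j _; apply: measurableI; last first.
    exact: measurable_funPTI.
  rewrite (_ : _ @^-1` _ = (fun w => k.+1%:R * tau w) @^-1` `[j%:R, j.+1%:R[).
    rewrite -[X in measurable X]setTI.
    have mf : measurable_fun [set: T] (fun w => k.+1%:R * tau w).
      apply: measurable_funM => //; exact: measurable_funPT.
    exact: mf.
  apply/seteqP; split => w /=; rewrite in_itv/=.
    move=> <-; apply: truncn_itv; by rewrite mulr_ge0// time_ge0.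
  by move=> h; apply: truncn_def.
- move=> w _.
  have [rc _] := levy_cadlag X w.
  have := rc _ (time_ge0 tau w) => /cvg_at_rightP; apply; split => //.
  apply: (@squeeze_cvgr _ _ _ _ (fun=> tau w)
    (fun k => tau w + k.+1%:R^-1)).
  + by apply: nearW => k; rewrite (ltW (rgt _ _)) rle.
  + exact: cvg_cst.
  + rewrite -[X in _ --> X]addr0; apply: cvgD; first exact: cvg_cst.
    exact: cvg_harmonic.
Qed.

Definition sample (R : realType) (d : measure_display)
    (T : measurableType d) (P : probability T R)
    (X : levy_process P) (tau : random_time P) (w : T) : R := X (tau w) w.

HB.instance Definition _ (R : realType) (d : measure_display)
    (T : measurableType d) (P : probability T R)
    (X : levy_process P) (tau : random_time P) :=
  isMeasurableFun.Build _ _ _ _ (sample X tau) (measurable_sample X tau).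

(* The random variables of a sequence may live on different probability
   spaces, so convergence in probability is only to a constant. *)
Definition cvg_in_probability_cst (R : realType) (d : nat -> measure_display)
    (T : forall n, measurableType (d n)) (P : forall n, probability (T n) R)
    (X : forall n, {RV P n >-> R}) (c : R) : Prop :=
  forall e : R, 0 < e ->
    P n [set w | e <= `|X n w - c|] @[n --> \oo] --> 0%E.
Arguments cvg_in_probability_cst {R d T} P X c.

Definition cvg_in_distribution (R : realType) (d : nat -> measure_display)
    (T : forall n, measurableType (d n)) (P : forall n, probability (T n) R)
    (X : forall n, {RV P n >-> R})
    (d' : measure_display) (T' : measurableType d') (P' : probability T' R)
    (Z : {RV P' >-> R}) : Prop :=
  forall f : R -> R, continuous f -> bounded_fun f ->
    'E_(P n)[f \o X n]%E @[n --> \oo] --> 'E_P'[f \o Z]%E.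
Arguments cvg_in_distribution {R d T} P X {d' T'} P' Z.

(* Main.v *)
(* A Levy process with [P(|X_u| > a) <= 1/8] cannot oscillate much on a short
   time interval: the oscillation on a window of length [tau * u] exceeds
   [eta * a] with probability at most [p], where [tau] depends on [eta] and [p]
   only. Indeed, such a process stays of order [a] up to time [u]; but if an
   increment over a short time [s] exceeded [eta * a] with non-negligible
   probability, then many consecutive such increments of the same sign would
   occur before time [u], by independence. No truncation or characteristic
   function is needed, and drifts are covered as well.
   Let [u = 1 - delta]. If [|X_T| <= K] with high probability, then
   [P(|X_u| > 4K) <= 1/8]: otherwise take [c >= 4K] with
   [P(|X_u| > c) > 1/8 >= P(|X_u| > 2c)]; by the above (with [a = 2c]), [X]
     moves
   by at most [c/4] between [u] and [T] with high probability, so that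
   [|X_u| <= K + c/4 < c], a contradiction. Hence the oscillation bound applies
     to
   all the processes of the sequence with the same [a = 4K], and
   [X_T - X_1 -> 0] in probability. *)
Require Import Defs.
From mathcomp Require Import all_boot all_order all_algebra.
From mathcomp Require Import all_classical all_reals all_analysis.
From mathcomp Require Import measurable_realfun.
From mathcomp Require Import lra ring zify.
Set Implicit Arguments.
Unset Strict Implicit.
Unset Printing Implicit Defensive.
Import Order.TTheory GRing.Theory Num.Theory.
Import numFieldNormedType.Exports.
Local Open Scope classical_set_scope.
Local Open Scope ring_scope.

(** * Real-valued probabilities *)

Definition pr (R : realType) (d : measure_display) (T : measurableType d)
  (P : probability T R) (A : set T) : R := fine (P A).

Lemma prE (R : realType) (d : measure_display) (T : measurableType d)
    (P : probability T R) (A : set T) : measurable A -> P A = (pr P A)%:E.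
Proof. by move=> mA; rewrite /pr fineK// fin_num_measure. Qed.

Lemma pr_ge0 (R : realType) (d : measure_display) (T : measurableType d)
    (P : probability T R) (A : set T) : 0 <= pr P A.
Proof. exact: fine_ge0. Qed.

Lemma pr_setT (R : realType) (d : measure_display) (T : measurableType d)
    (P : probability T R) : pr P setT = 1.
Proof. by rewrite /pr probability_setT. Qed.

Lemma pr_set0 (R : realType) (d : measure_display) (T : measurableType d)
    (P : probability T R) : pr P set0 = 0.
Proof. by rewrite /pr measure0. Qed.

Lemma pr_le (R : realType) (d : measure_display) (T : measurableType d)
    (P : probability T R) (A B : set T) :
  measurable A -> measurable B -> A `<=` B -> pr P A <= pr P B.
Proof.
by move=> mA mB AB; rewrite -lee_fin -!prE// le_measure ?inE.
Qed.

Lemma pr_le1 (R : realType) (d : measure_display) (T : measurableType d)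
    (P : probability T R) (A : set T) : measurable A -> pr P A <= 1.
Proof. by move=> mA; rewrite -lee_fin -prE// probability_le1. Qed.

Lemma pr_setU_le (R : realType) (d : measure_display) (T : measurableType d)
    (P : probability T R) (A B : set T) :
  measurable A -> measurable B -> pr P (A `|` B) <= pr P A + pr P B.
Proof.
move=> mA mB; rewrite -lee_fin EFinD -!prE ?measureU2//.
exact: measurableU.
Qed.

Lemma pr_split (R : realType) (d : measure_display) (T : measurableType d)
    (P : probability T R) (A B : set T) :
  measurable A -> measurable B -> pr P A = pr P (A `\` B) + pr P (A `&` B).
Proof.
move=> mA mB; apply: EFin_inj.
rewrite EFinD -!prE//; first exact: measureDI.
- exact: measurableI.
- exact: measurableD.
Qed.

Lemma pr_setC (R : realType) (d : measure_display) (T : measurableType d)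
    (P : probability T R) (A : set T) : measurable A ->
      pr P (~` A) = 1 - pr P A.
Proof.
by move=> mA; have := pr_split P measurableT mA; rewrite pr_setT setTD setTI;
  lra.
Qed.

Lemma pr_exists3 (R : realType) (d : measure_display) (T : measurableType d)
    (P : probability T R) (A B C : set T) :
  measurable A -> measurable B -> measurable C ->
  pr P A + pr P B + pr P C < 1 -> exists w, [/\ ~ A w, ~ B w & ~ C w].
Proof.
move=> mA mB mC lt1; apply: contrapT => H.
have : [set: T] `<=` (A `|` B) `|` C.
  move=> w _; apply: contrapT => K; apply: H; exists w.
  by split => ?; apply: K; [left; left|left; right|right].
move=> /(pr_le P measurableT (measurableU _ _ (measurableU _ _ mA mB) mC)).
rewrite pr_setT.
have := pr_setU_le P (measurableU _ _ mA mB) mC.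
have := pr_setU_le P mA mB; lra.
Qed.

Lemma pr_setU (R : realType) (d : measure_display) (T : measurableType d)
    (P : probability T R) (A B : set T) : measurable A -> measurable B ->
  A `&` B = set0 -> pr P (A `|` B) = pr P A + pr P B.
Proof.
move=> mA mB AB; rewrite (pr_split P (measurableU _ _ mA mB) mB).
congr (pr P _ + pr P _); apply/seteqP; split => w.
- by move=> [[]].
- by move=> Aw; split; [left|move=> Bw; have : set0 w by rewrite -AB].
- by move=> [].
- by move=> Bw; split; [right|].
Qed.

Definition far (R : realType) (c : R) : set R := [set y | c < `|y|].

Lemma measurable_far (R : realType) (c : R) : measurable (far c).
Proof.
have := @normr_measurable R setT measurableT _ (measurable_itv `]c, +oo[).
by rewrite setTI; congr measurable; apply/seteqP; split => y;
  rewrite /far/= in_itv/= andbT.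
Qed.

Lemma measurable_above (R : realType) (c sg : R) :
  measurable [set y | c < sg * y].
Proof.
have := @mulrl_measurable R setT sg measurableT _ (measurable_itv `]c, +oo[).
rewrite setTI; congr measurable; apply/seteqP; split => y /=;
  by rewrite in_itv/= andbT.
Qed.

Lemma measurable_mfun_preimage (R : realType) (d : measure_display)
    (T : measurableType d) (Y : {mfun T >-> R}) (B : set R) :
  measurable B -> measurable (Y @^-1` B).
Proof. by move=> mB; rewrite -[X in measurable X]setTI;
  exact: measurable_funPT. Qed.

(** * Independence of the past and of the next increment *)

Definition rectangles (R : realType) (d : measure_display)
    (T : measurableType d)
    (P : probability T R) (X : levy_process P) (t : nat -> R) (k : nat) :
    set (set T) :=
  [set E | exists B : nat -> set R, (forall i, measurable (B i)) /\
    E = \bigcap_(i in `I_k) (increment X (t i) (t i.+1) @^-1` B i)].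

Definition past (R : realType) (d : measure_display) (T : measurableType d)
    (P : probability T R) (X : levy_process P) (t : nat -> R) (k : nat) :
    set (set T) := <<s rectangles X t k>>.

Lemma measurable_increment_preimage (R : realType) (d : measure_display)
    (T : measurableType d) (P : probability T R) (X : levy_process P) (s t : R)
    (B : set R) : measurable B -> measurable (increment X s t @^-1` B).
Proof.
by move=> mB; have := measurable_increment X s t measurableT mB; rewrite setTI.
Qed.

Lemma rectangles_measurable (R : realType) (d : measure_display)
    (T : measurableType d) (P : probability T R) (X : levy_process P)
    (t : nat -> R) (k : nat) : rectangles X t k `<=` measurable.
Proof.
move=> _ [B [mB ->]]; apply: bigcap_measurableType => i _.
exact: measurable_increment_preimage.
Qed.

Lemma past_measurable (R : realType) (d : measure_display)
    (T : measurableType d) (P : probability T R) (X : levy_process P)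
    (t : nat -> R) (k : nat) : past X t k `<=` measurable.
Proof.
apply: smallest_sub; last exact: rectangles_measurable.
exact: sigma_algebra_measurable.
Qed.

Lemma rectangles_setI (R : realType) (d : measure_display)
    (T : measurableType d) (P : probability T R) (X : levy_process P)
    (t : nat -> R) (k : nat) : setI_closed (rectangles X t k).
Proof.
move=> _ _ [B [mB ->]] [C [mC ->]]; exists (fun i => B i `&` C i); split.
  by move=> i; exact: measurableI.
by rewrite -bigcapI; apply: eq_bigcapr => i _; rewrite preimage_setI.
Qed.

Lemma rectangle_prod (R : realType) (d : measure_display)
    (T : measurableType d) (P : probability T R) (X : levy_process P)
    (t : nat -> R) (k : nat) (B : nat -> set R) :
  0 <= t 0%N -> (forall i, (i < k)%N -> t i <= t i.+1) ->
  (forall i, measurable (B i)) ->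
  pr P (\bigcap_(i in `I_k) (increment X (t i) (t i.+1) @^-1` B i)) =
  \prod_(i < k) pr P (increment X (t i) (t i.+1) @^-1` B i).
Proof.
move=> t0 tk mB.
have /(_ [set: 'I_k]%SET (fun i => B i)) H := levy_independent X t0 tk.
apply: EFin_inj; rewrite -prE; last first.
  apply: bigcap_measurableType => i _; exact: measurable_increment_preimage.
rewrite -prodEFin.
transitivity (P (\bigcap_(i in [set` [set: 'I_k]%SET])
  (increment X (t (i : 'I_k)) (t i.+1) @^-1` B i))).
  congr (P _); apply/seteqP; split => [w Hw i _|w Hw i /= ik].
    by apply: Hw => /=.
  by apply: (Hw (Ordinal ik)) => /=; rewrite inE.
rewrite H//; apply: eq_big => [i|i _]; first by rewrite inE.
rewrite prE//; exact: measurable_increment_preimage.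
Qed.

Lemma past_indep (R : realType) (d : measure_display)
    (T : measurableType d) (P : probability T R) (X : levy_process P)
    (t : nat -> R) (k : nat) (u : R) (E : set T) (B : set R) :
  0 <= t 0%N -> (forall i, (i < k)%N -> t i <= t i.+1) -> t k <= u ->
  past X t k E -> measurable B ->
  pr P (E `&` increment X (t k) u @^-1` B) =
  pr P E * pr P (increment X (t k) u @^-1` B).
Proof.
move=> t0 tk ku pE mB; set F := _ @^-1` B.
have mF : measurable F by exact: measurable_increment_preimage.
pose H := [set E : set T | measurable E /\ P (E `&` F) = (P E * P F)%E].
suff: past X t k `<=` H.
  move=> /(_ _ pE)[mE PE]; apply: EFin_inj; rewrite EFinM -!prE//.
  exact: measurableI.
apply: lambda_system_subset => //; first exact: rectangles_setI.
  apply/dynkin_lambda_system; split.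
  - by split => //; rewrite setTI probability_setT mul1e.
  - move=> A [mA PA]; split; first exact: measurableC.
    rewrite !prE//; [|exact: measurableC|by apply: measurableI => //;
      exact: measurableC].
    rewrite -EFinM pr_setC//; congr EFin.
    have := pr_split P mF mA; rewrite setDE (setIC F (~` A)).
    have : pr P (A `&` F) = pr P A * pr P F.
      apply: EFin_inj; rewrite EFinM -!prE//; exact: measurableI.
    by rewrite (setIC F A) => ->; nra.
  - move=> G tG HG; split; first by apply: bigcup_measurable => i _;
    exact: (HG i).1.
    rewrite setI_bigcupl measure_bigcup//; last 2 first.
      by move=> i _; apply: measurableI => //; exact: (HG i).1.
      exact: trivIset_setIr.
    rewrite measure_bigcup//; last by move=> i _; exact: (HG i).1.
    rewrite muleC prE// -nneseriesZl//.
    apply: eq_eseriesr => i _; rewrite -prE// muleC; exact: (HG i).2.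
move=> E' [C [mC ->]]; split; first by apply: rectangles_measurable; exists C.
pose t' i := if (i <= k)%N then t i else u.
pose C' i := if (i < k)%N then C i else B.
have mC' i : measurable (C' i) by rewrite /C'; case: ifP.
have t'0 : 0 <= t' 0%N by [].
have t'S i : (i < k)%N -> t' i = t i /\ t' i.+1 = t i.+1.
  by move=> ik; rewrite /t' ik (ltnW ik).
have t'k i : (i < k.+1)%N -> t' i <= t' i.+1.
  rewrite ltnS leq_eqVlt => /orP[/eqP->|ik]; first by rewrite /t' leqnn ltnn.
  by have [-> ->] := t'S _ ik; exact: tk.
have t'1 : t' k = t k /\ t' k.+1 = u by rewrite /t' leqnn ltnn.
have := rectangle_prod X t'0 t'k mC'; rewrite big_ord_recr/=.
have -> : \bigcap_(i in `I_k.+1) (increment X (t' i) (t' i.+1) @^-1` C' i) =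
  \bigcap_(i in `I_k) (increment X (t i) (t i.+1) @^-1` C i) `&` F.
  rewrite -setIC; apply/seteqP; split => [w Hw|w [Fw Hw] i /=].
    split; first by have := Hw k (ltnSn k); rewrite t'1.1 t'1.2 /C' ltnn.
    move=> i /= ik; have /= := Hw i (ltnW ik).
    by have [-> ->] := t'S _ ik; rewrite /C' ik.
  rewrite ltnS leq_eqVlt => /orP[/eqP->|ik].
    by rewrite t'1.1 t'1.2 /C' ltnn.
  by have [-> ->] := t'S _ ik; rewrite /C' ik; exact: Hw.
rewrite t'1.1 t'1.2 {2}/C' ltnn -/F => HP.
rewrite !prE//; last 2 first.
- by apply: rectangles_measurable; exists C.
- by apply: measurableI => //; apply: rectangles_measurable; exists C.
rewrite -EFinM HP (rectangle_prod X t0 tk mC); congr (_ * _)%:E.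
apply: eq_bigr => i _; have [-> ->] := t'S _ (ltn_ord i).
by rewrite /C' ltn_ord.
Qed.

Lemma far_preimageC (R : realType) (T : Type) (f : T -> R) (c : R) :
  f @^-1` [set y | `|y| <= c] = ~` (f @^-1` far c).
Proof.
by apply/seteqP; split => w; rewrite /far/= leNgt => /negP.
Qed.

Lemma stationary_pr (R : realType) (d : measure_display)
    (T : measurableType d) (P : probability T R) (X : levy_process P)
    (s u : R) (B : set R) : 0 <= s -> s <= u -> measurable B ->
  pr P (increment X s u @^-1` B) = pr P (X (u - s) @^-1` B).
Proof. by move=> s0 su mB; rewrite /pr; congr fine; exact: levy_stationary. Qed.

Lemma sub_past (R : realType) (d : measure_display) (T : measurableType d)
    (P : probability T R) (X : levy_process P) (t : nat -> R) (k k' : nat) :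
  (k <= k')%N -> past X t k `<=` past X t k'.
Proof.
move=> kk'; apply: smallest_sub; first exact: smallest_sigma_algebra.
move=> _ [B [mB ->]]; apply: sub_gen_smallest.
exists (fun i => if (i < k)%N then B i else setT); split.
  by move=> i; case: ifP.
apply/seteqP; split => w Hw i /= ik.
  by case: ifPn => // ik'; exact: Hw.
by have := Hw i (leq_trans ik kk'); rewrite ik.
Qed.

Lemma past_step (R : realType) (d : measure_display) (T : measurableType d)
    (P : probability T R) (X : levy_process P) (t : nat -> R) (k i : nat)
    (B : set R) : (i < k)%N -> measurable B ->
  past X t k (increment X (t i) (t i.+1) @^-1` B).
Proof.
move=> ik mB; apply: sub_gen_smallest.
exists (fun j => if j == i then B else setT); split; first by move=> j;
  case: ifP.
apply/seteqP; split => [w Hw j /= _|w Hw].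
  by case: eqP => [->|].
by have := Hw i ik; rewrite eqxx.
Qed.

Lemma past_partial (R : realType) (d : measure_display) (T : measurableType d)
    (P : probability T R) (X : levy_process P) (t : nat -> R) (k j : nat)
    (B : set R) : (j <= k)%N -> measurable B ->
  past X t k (increment X (t 0%N) (t j) @^-1` B).
Proof.
move=> jk mB.
suff H : measurable_fun setT
    (increment X (t 0%N) (t j) : g_sigma_algebraType (rectangles X t k) -> R).
  by have := H measurableT _ mB; rewrite setTI.
elim: j jk => [_|j IH jk].
  have -> : increment X (t 0%N) (t 0%N) = cst 0.
    by apply/funext => w; rewrite /increment subrr.
  exact: measurable_cst.
have -> : increment X (t 0%N) (t j.+1) =
    increment X (t 0%N) (t j) \+ increment X (t j) (t j.+1).
  by apply/funext => w; rewrite /increment/=; lra.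
apply: measurable_funD; first exact: IH (ltnW jk).
by move=> _ C mC; rewrite setTI; exact: past_step.
Qed.

Definition stays (R : realType) (d : measure_display) (T : measurableType d)
    (P : probability T R) (X : levy_process P) (t : nat ->
      R) (b : R) (k : nat) :
    set T :=
  \bigcap_(j in `I_k.+1) (increment X (t 0%N) (t j) @^-1` [set y | `|y| <= b]).

Lemma past_stays (R : realType) (d : measure_display) (T : measurableType d)
    (P : probability T R) (X : levy_process P) (t : nat ->
      R) (b : R) (k : nat) :
  past X t k (stays X t b k).
Proof.
suff : measurable (stays X t b k : set (g_sigma_algebraType (rectangles X t
  k))).
  by [].
apply: bigcap_measurable => [|j /= jk]; first by exists 0%N.
rewrite far_preimageC; apply: measurableC.
by apply: past_partial => //; exact: measurable_far.
Qed.

Lemma staysS (R : realType) (d : measure_display) (T : measurableType d)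
    (P : probability T R) (X : levy_process P) (t : nat ->
      R) (b : R) (k : nat) :
  stays X t b k.+1 =
  stays X t b k `&` ~` (increment X (t 0%N) (t k.+1) @^-1` far b).
Proof.
rewrite -far_preimageC; apply/seteqP; split => [w H|w [H Hk] j /=].
  by split; [move=> j jk; apply: H; exact: ltnW|exact: (H k.+1 (ltnSn _))].
by rewrite ltnS leq_eqVlt => /orP[/eqP->//|]; exact: H.
Qed.

Lemma sub_stays (R : realType) (d : measure_display) (T : measurableType d)
    (P : probability T R) (X : levy_process P) (t : nat -> R) (b : R)
    (k k' : nat) : (k <= k')%N -> stays X t b k' `<=` stays X t b k.
Proof. by move=> kk' w H j /= jk; apply: H; exact: leq_trans jk _. Qed.

(** * Maximal inequality and runs of large increments *)

Lemma ottaviani (R : realType) (d : measure_display) (T : measurableType d)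
    (P : probability T R) (X : levy_process P) (t : nat -> R) (b p : R)
    (N : nat) :
  0 <= t 0%N -> (forall i j, (i <= j <= N)%N -> t i <= t j) -> 0 <= b ->
  p <= 2^-1 ->
  (forall i, (i <= N)%N -> pr P (increment X (t i) (t N) @^-1` far b) <= p) ->
  pr P (~` stays X t (2 * b) N) <= 2 * p.
Proof.
move=> t0 tN b0 p2 H; set F := increment X (t 0%N) (t N) @^-1` far b.
have mi s u c : measurable (increment X s u @^-1` far c).
  by apply: measurable_increment_preimage; exact: measurable_far.
have mF : measurable F by exact: mi.
have ms k : measurable (stays X t (2 * b) k).
  by apply: past_measurable; exact: past_stays.
suff Hk k : (k <= N)%N -> pr P (~` stays X t (2 * b) k) <=
    2 * pr P (~` stays X t (2 * b) k `&` F).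
  have := Hk N (leqnn N).
  have : pr P (~` stays X t (2 * b) N `&` F) <= pr P F.
    by apply: pr_le => //; apply: measurableI => //; exact: measurableC.
  by have := H 0%N (leq0n _); rewrite -/F; lra.
elim: k => [_|k IH kN].
  have -> : ~` stays X t (2 * b) 0 = set0.
    apply/seteqP; split => // w; apply => j /=; rewrite ltnS leqn0 => /eqP->.
    by rewrite /increment subrr normr0; lra.
  by rewrite set0I pr_set0 mulr0.
pose E := stays X t (2 * b) k `&` (increment X (t 0%N) (t k.+1) @^-1` far (2 *
  b)).
have mE : measurable E by exact: measurableI.
have SE : ~` stays X t (2 * b) k.+1 = ~` stays X t (2 * b) k `|` E.
  rewrite staysS setCI setCK /E; apply/seteqP; split => w.
    by move=> [|h]; [left|case: (pselect (stays X t (2 * b) k w));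
      [right|left]].
  by move=> [|[_]]; [left|right].
have dE : ~` stays X t (2 * b) k `&` E = set0.
  by rewrite /E setIA setICl set0I.
have mC := measurableC (ms k).
rewrite SE pr_setU// setIUl pr_setU//; last 3 first.
- exact: measurableI.
- exact: measurableI.
- by rewrite setIACA dE set0I.
have {}IH := IH (ltnW kN).
suff : pr P E <= 2 * pr P (E `&` F) by lra.
pose G := increment X (t k.+1) (t N) @^-1` far b.
have mG : measurable G by exact: mi.
have GE : pr P (E `&` G) = pr P E * pr P G.
  apply: past_indep => //.
  - by move=> i ik; apply: tN; rewrite leqnSn/=; exact: leq_trans ik kN.
  - by apply: tN; rewrite kN leqnn.
  - rewrite /E; have : measurable (stays X t (2 * b) k `&`
        (increment X (t 0%N) (t k.+1) @^-1` far (2 * b))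
        : set (g_sigma_algebraType (rectangles X t k.+1))); last by [].
    have Sk : past X t k.+1 (stays X t (2 * b) k).
      by apply: (sub_past (leqnSn k)); exact: past_stays.
    apply: measurableI; first exact: Sk.
    by apply: past_partial => //; exact: measurable_far.
  - exact: measurable_far.
have EG : E `\` G `<=` E `&` F.
  move=> w [Ew nG]; split => //; move: Ew nG => [_]; rewrite /G /F /far/=.
  rewrite /increment => E1 /negP; rewrite -leNgt => E2.
  have := ler_normD (X (t N) w - X (t 0%N) w) (X (t k.+1) w - X (t N) w).
  rewrite (distrC (X (t k.+1) w)).
  have -> : X (t N) w - X (t 0%N) w + (X (t k.+1) w - X (t N) w) =
    X (t k.+1) w - X (t 0%N) w by lra.
  lra.
have := pr_le P (measurableD mE mG) (measurableI _ _ mE mF) EG.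
have := pr_split P mE mG; rewrite GE.
have := H _ kN; rewrite -/G; have := pr_ge0 P E; have := pr_ge0 P G; nra.
Qed.

(* From within [[-b, b]], a run of [L] increments beyond [c] in the direction
   [sg] leaves the interval. *)
Lemma stays_run (R : realType) (d : measure_display) (T : measurableType d)
    (P : probability T R) (X : levy_process P) (s b c sg : R) (k L : nat) :
  0 <= s -> `|sg| = 1 -> 2 * b < L%:R * c ->
  pr P (stays X (fun i => i%:R * s) b (k + L)) <=
  (1 - pr P (X s @^-1` [set y | c < sg * y]) ^+ L) *
    pr P (stays X (fun i => i%:R * s) b k).
Proof.
move=> s0 sg1 Lc; set t := fun i => _; set rho := pr P (X s @^-1` _).
have mC := measurable_above c sg.
have t0 : 0 <= t 0%N by rewrite /t mul0r.
have tS i : t i <= t i.+1 by rewrite /t ler_wpM2r// ler_nat.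
have ms k' : measurable (stays X t b k') by apply: past_measurable;
  exact: past_stays.
have [E [pE PE Es Ec]] : exists E, [/\ past X t (k + L) E,
    pr P E = rho ^+ L * pr P (stays X t b k), E `<=` stays X t b k &
    forall w, E w -> L%:R * c <= sg * (X (t (k + L)%N) w - X (t k) w)].
  move: (L) {Lc}; elim => [|l [E [pE PE Es Ec]]].
    exists (stays X t b k); rewrite addn0; split => //.
    - exact: past_stays.
    - by rewrite expr0 mul1r.
    - by move=> w _; rewrite subrr mulr0 mul0r.
  pose F := increment X (t (k + l)%N) (t (k + l).+1) @^-1` [set y | c < sg * y].
  exists (E `&` F); rewrite addnS; split.
  - have : measurable (E `&` F : set (g_sigma_algebraType
      (rectangles X t (k + l).+1))); last by [].
    apply: measurableI; last exact: past_step.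
    have : past X t (k + l).+1 E by apply: (sub_past (leqnSn _)).
    by [].
  - rewrite past_indep// PE exprS stationary_pr//; last first.
      by rewrite /t mulr_ge0.
    have -> : t (k + l).+1 - t (k + l)%N = s by rewrite /t -natr1; lra.
    by rewrite -/rho; lra.
  - by apply: subset_trans Es => w [].
  - by move=> w [/Ec + ]; rewrite /F/= /increment -natr1; lra.
have mE : measurable E by exact: past_measurable pE.
have : stays X t b (k + L) `<=` stays X t b k `\` E.
  move=> w H; split; first exact: (sub_stays (leq_addr _ _) H).
  move=> Ew; have := Ec _ Ew.
  have := H (k + L)%N (ltnSn _); have := Es _ Ew k (ltnSn _).
  have nsg y : `|sg * y| = `|y| by rewrite normrM sg1 mul1r.
  rewrite /= /increment -[X in X <= _ -> _]nsg -[X in _ -> X <= _ -> _]nsg.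
  rewrite !ler_norml; nra.
move=> /(pr_le P (ms _) (measurableD (ms _) mE)).
have := pr_split P (ms k) mE.
have -> : stays X t b k `&` E = E
  by apply/seteqP; split => w; [move=> []|move=> Ew; split; [exact: Es|]].
by rewrite PE; lra.
Qed.

Lemma stays_run_iter (R : realType) (d : measure_display) (T : measurableType d)
    (P : probability T R) (X : levy_process P) (s b c sg : R) (g L : nat) :
  0 <= s -> `|sg| = 1 -> 2 * b < L%:R * c ->
  pr P (stays X (fun i => i%:R * s) b (g * L)) <=
  (1 - pr P (X s @^-1` [set y | c < sg * y]) ^+ L) ^+ g.
Proof.
move=> s0 sg1 Lc; elim: g => [|g IH].
  by rewrite mul0n expr0 pr_le1//; apply: past_measurable; exact: past_stays.
rewrite mulSn addnC; apply: le_trans (stays_run _ _ s0 sg1 Lc) _.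
rewrite exprS ler_wpM2l// subr_ge0 exprn_ile1//; first exact: pr_ge0.
by apply: pr_le1; apply: measurable_mfun_preimage; exact: measurable_above.
Qed.

(** * Marginals before a time at which the process is bounded *)

(* A median up to an error [e]: this avoids the continuity of the distribution
   function from the left. *)
Lemma median (R : realType) (d : measure_display) (T : measurableType d)
    (P : probability T R) (Y : {RV P >-> R}) (e : R) : 0 < e ->
  exists x, 2^-1 <= pr P (Y @^-1` [set y | y <= x]) /\
    pr P (Y @^-1` [set y | y <= x - e]) < 2^-1.
Proof.
move=> e0.
have H r : cdf Y r = (pr P (Y @^-1` [set y | y <= r]))%:E.
  rewrite -prE; first by rewrite /cdf /distribution/= set_itvE.
  rewrite -[X in measurable X]setTI; apply: measurable_funPT => //.
  by have := measurable_itv `]-oo, r]; rewrite set_itvE.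
pose F r := pr P (Y @^-1` [set y | y <= r]).
have FE : fine \o cdf Y = F by apply/funext => r; rewrite /= H.
have F1 : F r @[r --> +oo] --> (1:R).
  have := fine_cvg (cvg_cdfy1 Y); rewrite FE; exact.
have F0 : F r @[r --> -oo] --> (0:R).
  have := fine_cvg (cvg_cdfNy0 Y); rewrite FE; exact.
have ndF x y : x <= y -> F x <= F y.
  by move=> xy; rewrite -lee_fin -!H; exact: cdf_nondecreasing.
pose A := [set r | 2^-1 <= F r].
have [M AM] : exists M, A M.
  move/cvgrPdist_lt : F1 => /(_ 2^-1); rewrite invr_gt0 ltr0n =>
    /(_ isT)[M [_ HM]].
  exists (M + 1); have /= := HM (M + 1); rewrite ltrDl ltr01 => /(_ isT).
  by rewrite /A/= ltr_norml; lra.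
have [m Am] : exists m, lbound A m.
  move/cvgrPdist_lt : F0 => /(_ 2^-1); rewrite invr_gt0 ltr0n =>
    /(_ isT)[m [_ Hm]].
  exists (m - 1) => r Ar; rewrite leNgt; apply/negP => rm.
  have /= := Hm (m - 1); rewrite gtrBl ltr01 => /(_ isT).
  have := ndF _ _ (ltW rm); move: Ar; rewrite /A/= ltr_norml; lra.
have hA : has_inf A by split; [exists M|exists m].
have [x Ax xe] := inf_adherent e0 hA.
exists x; split => //; rewrite ltNge; apply/negP => xA.
have := ge_inf (ex_intro _ m Am) xA; lra.
Qed.

Lemma pr_indep_increment (R : realType) (d : measure_display)
    (T : measurableType d) (P : probability T R) (X : levy_process P) (s u : R)
    (B C : set R) : 0 <= s -> s <= u -> measurable B -> measurable C ->
  pr P (X s @^-1` B `&` increment X s u @^-1` C) =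
  pr P (X s @^-1` B) * pr P (increment X s u @^-1` C).
Proof.
move=> s0 su mB mC; pose t i : R := if i is 0%N then 0 else s.
have X0 : increment X 0 s = X s.
  by apply/funext => w; rewrite /increment levy_start0 subr0.
rewrite -[X in X @^-1` B]X0.
have := @past_indep _ _ _ _ X t 1 u (increment X 0 s @^-1` B) C.
apply => //; first by case.
exact: (@past_step _ _ _ _ X t 1 0).
Qed.

(* If [x] is a median of [X u - X s], then [X s > 2 a - x] forces [X u > a] with
   conditional probability at least 1/2, and symmetrically; hence [y = - x]. *)
Lemma concentration (R : realType) (d : measure_display)
    (T : measurableType d) (P : probability T R) (X : levy_process P)
    (s u a : R) : 0 <= s -> s <= u -> 0 < a ->
  pr P (X u @^-1` far a) <= 8^-1 ->
  exists y, pr P (X s @^-1` [set z | 2 * a < `|z - y|]) <= 4^-1.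
Proof.
move=> s0 su a0 Ha; have [x [x1 x2]] := @median _ _ _ P (increment X s u) a a0.
exists (- x).
pose Ap : set R := [set` `]2 * a - x, +oo[]; pose Bp : set R :=
  ~` [set y : R | y <= x - a].
pose Am : set R := [set` `]-oo, - (2 * a) - x[]; pose Bm :=
  [set y : R | y <= x].
have mle (r : R) : measurable [set y : R | y <= r].
  by have := measurable_itv `]-oo, r]; rewrite set_itvE.
have mAp : measurable Ap by exact: measurable_itv.
have mAm : measurable Am by exact: measurable_itv.
have mBp : measurable Bp by apply: measurableC; exact: mle.
have mBm : measurable Bm by exact: mle.
have mX B : measurable B -> measurable (X s @^-1` B) by exact:
  measurable_mfun_preimage.
have mY B : measurable B -> measurable (increment X s u @^-1` B).
  exact: measurable_increment_preimage.
have mXp := mX _ mAp; have mXm := mX _ mAm.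
have mYp := mY _ mBp; have mYm := mY _ mBm.
have Ep := pr_indep_increment X s0 su mAp mBp.
have Em := pr_indep_increment X s0 su mAm mBm.
have Bp2 : 2^-1 <= pr P (increment X s u @^-1` Bp).
  by rewrite /Bp preimage_setC pr_setC; [lra|exact: (mY _ (mle _))].
have le1 : pr P ((X s @^-1` Ap `&` increment X s u @^-1` Bp) `|`
     (X s @^-1` Am `&` increment X s u @^-1` Bm)) <= 8^-1.
  apply: le_trans Ha; apply: pr_le.
  - by apply: measurableU; apply: measurableI.
  - by apply: measurable_mfun_preimage; exact: measurable_far.
  - move=> w; rewrite /Ap /Bp /Am /Bm /far /increment/= !in_itv/= andbT.
    move=> [[+ /negP]|[]]; rewrite -?ltNge ltr_normr; lra.
move: le1; rewrite pr_setU; [|exact: measurableI|exact: measurableI|];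
  last first.
  rewrite -subset0 => w [[+ _] [+ _]]; rewrite /Ap /Am/= !in_itv/= andbT; lra.
have le2 : pr P (X s @^-1` [set z | 2 * a < `|z - - x|]) <=
    pr P (X s @^-1` Ap) + pr P (X s @^-1` Am).
  apply: le_trans (pr_setU_le P (mX _ mAp) (mX _ mAm)).
  rewrite -preimage_setU.
  have -> : [set z : R | 2 * a < `|z - - x|] = Ap `|` Am; last by [].
  apply/seteqP; split => z; rewrite /Ap /Am /setU/= !in_itv/= andbT ltr_normr.
    by move=> /orP[|] ?; [left|right]; lra.
  by move=> [?|?]; apply/orP; [left|right]; lra.
rewrite Ep Em.
have := pr_ge0 P (X s @^-1` Ap); have := pr_ge0 P (X s @^-1` Am).
nra.
Qed.

Lemma quasi_additive_bound (R : realFieldType) (N : nat) (y : nat ->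
  R) (c : R) :
  y N = 0 ->
  (forall i j, (i + j <= N)%N -> `|y (i + j)%N - y i - y j| <= c) ->
  forall i, (i <= N)%N -> `|y i| <= 3 * c.
Proof.
move=> yN qa i iN.
have [m _ /= Hm] := @arg_maxP _ _ _ (@ord0 N) xpredT (fun i => `|y i|) isT.
have {}Hm j : (j <= N)%N -> `|y j| <= `|y m|.
  by move=> jN; have := Hm (Ordinal (jN : (j < N.+1)%N)) isT.
apply: le_trans (Hm _ iN) _.
have db j : (j + j <= N)%N -> `|y j| * 2 <= `|y m| + c.
  move=> jN; have := qa _ _ jN; have := Hm _ jN.
  have := ler_normD (y (j + j)%N - (y (j + j)%N - y j - y j)) (- (y (j + j)%N)).
  by rewrite !ler_norml; case: (ger0P (y j)); case: (ger0P (y m)); lra.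
have mN : (m <= N)%N by rewrite -ltnS.
case: (leqP (m + m) N) => mm; first by have := db _ mm; have := normr_ge0 (y m);
  lra.
have jN : ((N - m) + (N - m) <= N)%N by lia.
have := db _ jN; have := qa m (N - m)%N; rewrite subnKC// leqnn yN => /(_ isT).
by rewrite !ler_norml; case: (ger0P (y m)); case: (ger0P (y (N - m)%N)); lra.
Qed.

(* The centerings given by [concentration] are additive up to [6 a], and the one
   at the final time can be taken to be [0]. *)
Lemma marginal_bound (R : realType) (d : measure_display)
    (T : measurableType d) (P : probability T R) (X : levy_process P)
    (u a : R) (N : nat) : 0 <= u -> (0 < N)%N -> 0 < a ->
  pr P (X u @^-1` far a) <= 8^-1 ->
  forall i, (i <= N)%N -> pr P (X (i%:R * (u / N%:R)) @^-1` far (20 * a)) <=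
    4^-1.
Proof.
move=> u0 N0 a0 Ha; set t := fun i : nat => i%:R * (u / N%:R).
have N0' : N%:R != 0 :> R by rewrite pnatr_eq0 -lt0n.
have tN : t N = u by rewrite /t mulrC divfK.
have t0 i : 0 <= t i by rewrite /t mulr_ge0// divr_ge0.
have tD i j : t (i + j)%N = t i + t j by rewrite /t natrD mulrDl.
have tle i j : (i <= j)%N -> t i <= t j.
  by move=> ij; rewrite /t ler_wpM2r ?ler_nat// divr_ge0.
have /choice[y yP] : forall i : nat, exists y : R, (i <= N)%N ->
    pr P (X (t i) @^-1` [set z | 2 * a < `|z - y|]) <= 4^-1.
  move=> i; case: (leqP i N) => iN; last by exists 0.
  have [|y yi] := concentration (t0 i) _ a0 Ha; last by exists y.
  by rewrite -tN tle.
pose z i := if i == N then 0 else y i.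
have mf v : measurable [set x : R | 2 * a < `|x - v|].
  have mv : measurable_fun [set: R] (fun x : R => x - v).
    by apply: measurable_funB; [exact: measurable_id|exact: measurable_cst].
  by have := mv measurableT _ (measurable_far (2 * a)); rewrite setTI.
have zP i : (i <= N)%N -> pr P (X (t i) @^-1` [set x | 2 * a < `|x - z i|]) <=
  4^-1.
  rewrite /z; case: eqP => [-> _|_ iN]; last exact: yP.
  rewrite tN; apply: (@le_trans _ _ (pr P (X u @^-1` far a))); last lra.
  apply: pr_le; [exact: measurable_mfun_preimage|
    by apply: measurable_mfun_preimage; exact: measurable_far|].
  by move=> w; rewrite /far/= subr0; lra.
have qa i j : (i + j <= N)%N -> `|z (i + j)%N - z i - z j| <= 6 * a.
  move=> ijN.
  have iN : (i <= N)%N by exact: leq_trans (leq_addr _ _) ijN.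
  have jN : (j <= N)%N by exact: leq_trans (leq_addl _ _) ijN.
  have := @stationary_pr _ _ _ _ X _ _ _ (t0 i) (tle _ _ (leq_addr j i)) (mf (z
    j)).
  rewrite [in RHS]tD addrAC subrr add0r => E.
  have [||||w [H1 H2 H3]] := @pr_exists3 _ _ _ P
      (X (t i) @^-1` [set x | 2 * a < `|x - z i|])
      (X (t (i + j)%N) @^-1` [set x | 2 * a < `|x - z (i + j)%N|])
      (increment X (t i) (t (i + j)%N) @^-1` [set x | 2 * a < `|x - z j|]).
  - exact: measurable_mfun_preimage.
  - exact: measurable_mfun_preimage.
  - exact: measurable_increment_preimage.
  - by rewrite E; have := zP _ iN; have := zP _ jN; have := zP _ ijN; lra.
  move: H1 H2 H3; rewrite /increment/= => /negP + /negP + /negP.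
  by rewrite -!leNgt !ler_norml; lra.
have zN : z N = 0 by rewrite /z eqxx.
move=> i iN; apply: le_trans (zP i iN).
apply: pr_le.
- by apply: measurable_mfun_preimage; exact: measurable_far.
- exact: measurable_mfun_preimage.
move=> w; rewrite /far/= => h.
have := quasi_additive_bound zN qa iN.
have := ler_normD (X (t i) w - z i) (z i); rewrite subrK; lra.
Qed.

(** * Oscillation on short intervals *)

Lemma exists_exprn_lt (R : realType) (q e : R) : 0 <= q < 1 -> 0 < e ->
  exists g : nat, q ^+ g < e.
Proof.
move=> /andP[q0 q1] e0.
have : q ^+ n @[n --> \oo] --> (0 : R) by apply: cvg_expr; rewrite ger0_norm.
move=> /cvgrPdist_lt/(_ _ e0)[n _ /(_ n (leqnn n))] /=.
by rewrite sub0r normrN ger0_norm ?exprn_ge0// => ?; exists n.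
Qed.

Lemma short_time_small (R : realType) (eta p : R) : 0 < eta -> 0 < p < 1 ->
  exists2 Q : nat, (0 < Q)%N & forall (d : measure_display)
    (T : measurableType d) (P : probability T R) (X : levy_process P)
    (u a : R) (N i : nat), 0 <= u -> (0 < N)%N -> 0 < a ->
    pr P (X u @^-1` far a) <= 8^-1 -> (Q * i <= N)%N ->
    pr P (X (i%:R * (u / N%:R)) @^-1` far (eta * a)) <= p.
Proof.
move=> eta0 /andP[p0 p1].
pose L := (Num.trunc (80 / eta)).+1.
have L80 : 80 < L%:R * eta by rewrite -ltr_pdivrMr// truncnS_gt.
have qL0 : 0 < (p / 2) ^+ L by rewrite exprn_gt0// divr_gt0.
have qL1 : (p / 2) ^+ L <= 1 by rewrite exprn_ile1//; lra.
have [g qg] : exists g : nat, (1 - (p / 2) ^+ L) ^+ g < 2^-1.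
  by apply: exists_exprn_lt; [lra|lra].
exists (g * L).+1 => // d T P X u a N i u0 N0 a0 Ha QiN.
rewrite leNgt; apply/negP => pX.
set s := i%:R * (u / N%:R) in pX.
have s0 : 0 <= s by rewrite mulr_ge0// divr_ge0.
have mXs sg := measurable_mfun_preimage (X s) (measurable_above (eta * a) sg).
have [sg sg1 rho] : exists2 sg : R, `|sg| = 1 &
    p / 2 < pr P (X s @^-1` [set y | eta * a < sg * y]).
  have : pr P (X s @^-1` far (eta * a)) <=
      pr P (X s @^-1` [set y | eta * a < 1 * y]) +
      pr P (X s @^-1` [set y | eta * a < -1 * y]).
    apply: le_trans (pr_setU_le P (mXs 1) (mXs (-1))); apply: pr_le.
    - by apply: measurable_mfun_preimage; exact: measurable_far.
    - by apply: measurableU.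
    - move=> w; rewrite /far/= ltr_normr => /orP[?|?]; [left|right]; rewrite /=;
      lra.
  case: (ltP (p / 2) (pr P (X s @^-1` [set y | eta * a < 1 * y]))) =>
    [h _|h1 h2].
    by exists 1; rewrite ?normr1.
  by exists (-1); rewrite ?normrN1//; lra.
have rho1 := pr_le1 P (mXs sg).
set t := fun j : nat => j%:R * s.
have tle i' j : (i' <= j)%N -> t i' <= t j.
  by move=> ij; rewrite /t ler_wpM2r// ler_nat.
have H : pr P (~` stays X t (2 * (20 * a)) (g * L)) <= 2 * 4^-1.
  apply: ottaviani.
  - by rewrite /t mul0r.
  - by move=> i' j /andP[]; move=> + _; exact: tle.
  - lra.
  - lra.
  - move=> j jN; rewrite stationary_pr//; last 3 first.
    + by rewrite /t mulr_ge0.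
    + exact: tle.
    + exact: measurable_far.
    have -> : t (g * L)%N - t j = ((g * L - j) * i)%:R * (u / N%:R).
      by rewrite /t /s [in RHS]natrM natrB//; lra.
    apply: marginal_bound => //; apply: leq_trans QiN.
    by rewrite leq_mul2r (leq_trans (leq_subr _ _) (leqnSn _)) orbT.
have := stays_run_iter X g s0 sg1 (_ : 2 * (2 * (20 * a)) < L%:R * (eta * a)).
move=> /(_ _)/wrap[]; first by nra.
have mS : measurable (stays X t (2 * (20 * a)) (g * L)).
  by apply: past_measurable; exact: past_stays.
move: H; rewrite pr_setC// -/t => H1 H2.
have : (1 - pr P (X s @^-1` [set y | eta * a < sg * y]) ^+ L) ^+ g <=
    (1 - (p / 2) ^+ L) ^+ g.
  apply: lerXn2r; rewrite ?nnegrE.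
  - by rewrite subr_ge0 exprn_ile1// pr_ge0.
  - lra.
  - rewrite lerD2l lerN2; apply: lerXn2r; rewrite ?nnegrE ?pr_ge0//; lra.
lra.
Qed.

Lemma levy_right_open (R : realType) (d : measure_display)
    (T : measurableType d) (P : probability T R) (X : levy_process P)
    (v s c : R) (w : T) : 0 <= s -> c < `|X s w - X v w| ->
  exists2 r : R, 0 < r & forall s', s < s' -> s' < s + r ->
    c < `|X s' w - X v w|.
Proof.
move=> s0 cX; have [rc _] := levy_cadlag X w.
pose e := `|X s w - X v w| - c.
have e0 : 0 < e by rewrite subr_gt0.
have /cvgrPdist_lt/(_ _ e0)[r /= r0 Hr] := rc _ s0.
exists r => // s' ss' s'r.
have := Hr s'; rewrite /= distrC ger0_norm ?subr_ge0 ?(ltW ss')//.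
move=> /(_ _ ss')/wrap[]; first by lra.
have := ler_normD (X s w - X s' w) (X s' w - X v w).
have -> : X s w - X s' w + (X s' w - X v w) = X s w - X v w by lra.
rewrite /e; lra.
Qed.

Lemma dyadic_point (R : realType) (u s r : R) (Q : nat) :
  0 < u -> 0 <= s -> 0 < r -> (0 < Q)%N -> s < u / Q%:R ->
  exists k j : nat, [/\ (j <= 2 ^ k %/ Q)%N, s < j%:R * (u / (2 ^ k)%:R) &
    j%:R * (u / (2 ^ k)%:R) < s + r].
Proof.
move=> u0 s0 r0 Q0 sQ; pose m := Num.min r (u / Q%:R - s).
have m0 : 0 < m by rewrite lt_min r0 subr_gt0.
pose k := (Num.trunc (u / m)).+1; pose h := u / (2 ^ k)%:R.
have k0 : 0 < (2 ^ k)%:R :> R by rewrite ltr0n expn_gt0.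
have h0 : 0 < h by rewrite divr_gt0.
have hm : h < m.
  rewrite ltr_pdivrMr// mulrC -ltr_pdivrMr//.
  by rewrite (lt_trans (truncnS_gt _))// ltr_nat ltn_expl.
have /andP[hr hQ] : (h < r) && (h < u / Q%:R - s) by rewrite -lt_min.
pose j := (Num.trunc (s / h)).+1.
have js : s < j%:R * h by rewrite -ltr_pdivrMr// truncnS_gt.
have jh : j%:R * h <= s + h.
  rewrite -natr1 mulrDl mul1r lerD2r -ler_pdivlMr//.
  by have /andP[] := truncn_itv (divr_ge0 s0 (ltW h0)).
exists k, j; rewrite -/h; split => //; last lra.
rewrite leq_divRL// -(ler_nat R) natrM.
have hE : (2 ^ k)%:R * h = u by rewrite mulrC divfK// gt_eqF.
have Qu : Q%:R * (u / Q%:R) = u by rewrite mulrC divfK// pnatr_eq0 -lt0n.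
have Q0' : 0 < Q%:R :> R by rewrite ltr0n.
rewrite -(ler_pM2r h0) hE -Qu mulrAC mulrC ler_pM2l//; lra.
Qed.

Lemma local_oscillation (R : realType) (eta p : R) : 0 < eta -> 0 < p < 1 ->
  exists2 tau : R, 0 < tau & forall (d : measure_display)
    (T : measurableType d) (P : probability T R) (X : levy_process P)
    (u a v : R), 0 < u -> 0 < a -> 0 <= v ->
    pr P (X u @^-1` far a) <= 8^-1 ->
    exists A : set T, [/\ measurable A, pr P A <= p &
      forall w s, v <= s < v + tau * u -> eta * a < `|X s w - X v w| -> A w].
Proof.
move=> eta0 /andP[p0 p1].
have eta2 : 0 < eta / 2 by rewrite divr_gt0.
have p2 : 0 < p / 2 < 1 by lra.
have [Q Q0 HQ] := short_time_small eta2 p2.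
exists Q%:R^-1; first by rewrite invr_gt0 ltr0n.
move=> d T P X u a v u0 a0 v0 Ha.
pose t k (j : nat) := v + j%:R * (u / (2 ^ k)%:R).
pose J k := (2 ^ k %/ Q)%N.
pose b := eta / 2 * a.
pose A k := ~` stays X (t k) (2 * b) (J k).
have mA k : measurable (A k).
  by apply: measurableC; apply: past_measurable; exact: past_stays.
have h0 k : 0 <= u / (2 ^ k)%:R by rewrite divr_ge0// ltW.
have tle k i j : (i <= j)%N -> t k i <= t k j.
  by move=> ij; rewrite /t lerD2l ler_wpM2r// ler_nat.
have t0 k i : 0 <= t k i by rewrite /t addr_ge0// mulr_ge0.
have pA k : pr P (A k) <= p.
  have -> : p = 2 * (p / 2) by lra.
  apply: ottaviani => //.
  - by move=> i j /andP[+ _]; exact: tle.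
  - by rewrite /b; nra.
  - lra.
  - move=> i iJ; rewrite stationary_pr//; [|exact: tle|exact: measurable_far].
    have -> : t k (J k) - t k i = (J k - i)%:R * (u / (2 ^ k)%:R).
      by rewrite /t natrB//; lra.
    apply: HQ => //; [exact: ltW|by rewrite expn_gt0|].
    apply: (@leq_trans (Q * J k)); first by rewrite leq_mul2l leq_subr orbT.
    by rewrite mulnC leq_divM.
have ndA : {homo A : n m / (n <= m)%N >-> (n <= m)%O}.
  apply: homo_leq => // [|k]; first exact: le_trans.
  apply/subsetPset; apply: subsetC => w H j /= jJ.
  have -> : t k j = t k.+1 (j * 2)%N.
    rewrite /t natrM expnS natrM; congr (v + _).
    by rewrite invfM mulrCA -!mulrA; field.
  have -> : t k 0%N = t k.+1 0%N by rewrite /t !mul0r.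
  have jQ : (j * Q <= 2 ^ k)%N by rewrite -leq_divRL.
  by apply: H; rewrite /= ltnS /J leq_divRL// expnS; lia.
exists (\bigcup_k A k); split.
- exact: bigcup_measurable.
- have mUA : measurable (\bigcup_k A k) by exact: bigcup_measurable.
  rewrite -lee_fin -prE//; apply: cvge_le (nondecreasing_cvg_mu mA mUA ndA).
  by apply: nearW => k /=; rewrite prE// lee_fin.
- move=> w s /andP[vs sv] Xs.
  have [r r0 Hr] := levy_right_open (le_trans v0 vs) Xs.
  have sv0 : 0 <= s - v by rewrite subr_ge0.
  have svQ : s - v < u / Q%:R by rewrite mulrC in sv; lra.
  have [k [j [jJ js jr]]] := dyadic_point u0 sv0 r0 Q0 svQ.
  exists k => // /(_ j); rewrite /= ltnS => /(_ jJ).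
  have -> : t k 0%N = v by rewrite /t mul0r addr0.
  rewrite /increment leNgt => /negP; apply.
  have -> : 2 * b = eta * a by rewrite /b; lra.
  by apply: Hr; rewrite /t; lra.
Qed.

(** * Convergence in distribution *)

Lemma bounded_integrable (R : realType) (d : measure_display)
    (T : measurableType d) (P : probability T R) (f : T -> R) (M : R) :
  measurable_fun setT f -> (forall w, `|f w| <= M) ->
  P.-integrable setT (EFin \o f).
Proof.
move=> mf fM; apply: measurable_bounded_integrable => //.
  by rewrite (le_lt_trans (probability_le1 _ _))// ltry.
exists M; split; first exact: num_real.
by move=> x Mx w _; exact: le_trans (fM w) (ltW Mx).
Qed.

Lemma bounded_expectation (R : realType) (d : measure_display)
    (T : measurableType d) (P : probability T R) (f : T -> R) (M : R) :
  measurable_fun setT f -> (forall w, `|f w| <= M) ->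
  'E_P[f]%E = (\int[P]_w f w)%:E.
Proof.
move=> mf fM; rewrite unlock /Rintegral fineK//.
by apply: integrable_fin_num => //; exact: bounded_integrable fM.
Qed.

Lemma Rintegral_le_indic (R : realType) (d : measure_display)
    (T : measurableType d) (P : probability T R) (f g : T -> R) (M c m : R)
    (B : set T) : measurable_fun setT f -> measurable_fun setT g ->
  (forall w, `|f w| <= M) -> (forall w, `|g w| <= M) -> measurable B ->
  (forall w, f w <= g w + c + m * \1_B w) ->
  \int[P]_w f w <= \int[P]_w g w + c + m * pr P B.
Proof.
move=> mf mg fM gM mB fg.
have If := bounded_integrable P mf fM; have Ig := bounded_integrable P mg gM.
have Ic : P.-integrable setT (EFin \o (fun=> c)).
  by apply: (@bounded_integrable _ _ _ _ _ `|c|).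
have IB : P.-integrable setT (EFin \o (\1_B : T -> R)).
  by apply: integrable_indic.
have ImB : P.-integrable setT (EFin \o (fun w => m * \1_B w)).
  rewrite (_ : EFin \o _ = (fun w => m%:E * (\1_B w)%:E)%E).
    exact: integrableZl.
  by apply/funext => w /=; rewrite EFinM.
have Igc : P.-integrable setT (EFin \o (fun w => g w + c)).
  rewrite (_ : EFin \o _ = (EFin \o g) \+ (EFin \o (fun=> c)))%E;
    first exact: integrableD.
  by apply/funext => w /=; rewrite EFinD.
have -> : \int[P]_w g w + c + m * pr P B = \int[P]_w (g w + c + m * \1_B w).
  rewrite RintegralD// RintegralD// RintegralZl// Rintegral_cst//.
  rewrite (_ : fine _ = 1); last by rewrite -/(pr P setT) pr_setT.
  rewrite mulr1; congr (_ + _ * _).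
  by rewrite /Rintegral integral_indic// setIT.
apply: le_Rintegral => //.
rewrite (_ : EFin \o _ = (EFin \o (fun w => (g w + c)%R)) \+
  (EFin \o (fun w => (m * \1_B w)%R)))%E; first exact: integrableD.
by apply/funext => w /=; rewrite EFinD.
Qed.

Lemma continuous_unif_segment (R : realType) (f : R -> R) (K e : R) :
  continuous f -> 0 < e ->
  exists2 eta : R, 0 < eta & forall x y, `|x| <= K -> `|x - y| <= eta ->
    `|f x - f y| <= e.
Proof.
move=> cf e0.
have /compact_near_coveringP cK := @segment_compact R (- K) K.
have e2 : 0 < e / 2 by rewrite divr_gt0.
have [eta /= eta0 H] : \forall eta \near (0:R)^'+,
    `[- K, K]%classic `<=` [set x | forall y, `|x - y| <= eta ->
      `|f x - f y| <= e].
  apply: (cK R (0:R)^'+) => x _.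
  have /cvgrPdist_lt/(_ _ e2)[r /= r0 Hr] := cf x.
  have r2 : 0 < r / 2 by rewrite divr_gt0.
  exists (ball x (r / 2), [set eta | eta < r / 2]).
    by split; [exact: nbhsx_ballx|exact: nbhs_right_lt].
  move=> [x' eta] [/= xx' etar] y x'y.
  have h1 := Hr x' (_ : ball x r x').
  have h2 := Hr y (_ : ball x r y).
  move: xx'; rewrite /ball/= => xx'.
  have {}h1 : `|f x - f x'| < e / 2 by apply: h1; rewrite /ball/=; lra.
  have {}h2 : `|f x - f y| < e / 2.
    apply: h2; rewrite /ball/=; have := ler_normD (x - x') (x' - y).
    by rewrite addrA subrK; lra.
  have := ler_normB (f x - f y) (f x - f x').
  have -> : f x - f y - (f x - f x') = f x' - f y by lra.
  lra.
exists (eta / 2); first by rewrite divr_gt0.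
move=> x y xK xy; have := H (eta / 2); rewrite /= sub0r normrN gtr0_norm
  ?divr_gt0//.
move=> /(_ _ _ x)/=; apply => //; first lra.
by rewrite in_itv/= -ler_norml.
Qed.

Lemma pr_far_small (R : realType) (d : measure_display) (T : measurableType d)
    (P : probability T R) (Y : {RV P >-> R}) (e : R) : 0 < e ->
  exists n : nat, forall m : nat, (n <= m)%N -> pr P (Y @^-1` far m%:R) <= e.
Proof.
move=> e0; pose F (n : nat) := Y @^-1` far n%:R.
have mF n : measurable (F n).
  by apply: measurable_mfun_preimage; exact: measurable_far.
have ndF : {homo F : n m / (n <= m)%N >-> (m <= n)%O}.
  by move=> n m nm; apply/subsetPset => w; rewrite /F /far/=;
    apply: le_lt_trans; rewrite ler_nat.
have F0 : \bigcap_n F n = set0.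
  apply/seteqP; split => // w /(_ (Num.trunc `|Y w|).+1 I).
  by rewrite /F /far/= ltNge => /negP; apply; rewrite ltW// truncnS_gt.
have := @nonincreasing_cvg_mu _ _ _ P F _ mF _ ndF.
rewrite F0 measure0 => /(_ _ measurable0)/wrap[].
  by rewrite (le_lt_trans (probability_le1 _ _))// ltry.
move=> /fine_cvgP[_ /cvgrPdist_le/(_ _ e0)[n _ Hn]].
exists n => m nm; have := Hn m nm; rewrite /= sub0r normrN; apply: le_trans.
exact: ler_norm.
Qed.

Lemma cvg_in_distribution_Rintegral (R : realType) (d : nat -> measure_display)
    (T : forall n, measurableType (d n)) (P : forall n, probability (T n) R)
    (Y : forall n, {RV P n >-> R}) (d' : measure_display)
    (T' : measurableType d') (P' : probability T' R) (Z : {RV P' >-> R}) :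
  cvg_in_distribution P Y P' Z <->
  forall (f : R -> R) (M : R), continuous f -> (forall x, `|f x| <= M) ->
    forall e : R, 0 < e -> exists n0 : nat, forall n, (n0 <= n)%N ->
      `|\int[P' ]_w f (Z w) - \int[P n]_w f (Y n w)| <= e.
Proof.
have mcomp d1 (T1 : measurableType d1) (f : R -> R) (V : {mfun T1 >-> R}) :
    continuous f -> measurable_fun setT (f \o V).
  move=> cf; apply: measurableT_comp; last exact: measurable_funPT.
  exact: continuous_measurable_fun.
have fineE d1 (T1 : measurableType d1) (Q : probability T1 R) (f : T1 -> R) :
    fine 'E_Q[f] = \int[Q]_w f w.
  by rewrite unlock.
split=> [YZ f M cf fM e e0|H f cf bf].
  have bf : bounded_fun f.
    exists M; split; first exact: num_real.
    by move=> x Mx w _; exact: le_trans (fM w) (ltW Mx).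
  have := YZ f cf bf.
  rewrite (@bounded_expectation _ _ _ P' _ M (mcomp _ _ _ Z cf) (fun w =>
    fM (Z w))).
  move=> /fine_cvgP[_ /cvgrPdist_le/(_ _ e0)[n0 _ Hn]].
  by exists n0 => n nn; have := Hn n nn; rewrite /= fineE.
have [M _ bM] := ex_strict_bound_gt0 bf.
have fM x : `|f x| <= M by apply: ltW; exact: (bM x I).
rewrite (@bounded_expectation _ _ _ P' _ M (mcomp _ _ _ Z cf) (fun w =>
  fM (Z w))).
apply/fine_cvgP; split.
  apply: nearW => n.
  by rewrite (@bounded_expectation _ _ _ (P n) _ M (mcomp _ _ _ (Y n) cf) (fun w
    => fM (Y n w))).
apply/cvgrPdist_le => e e0; have [n0 Hn] := H f M cf fM e e0.
by exists n0 => // n nn; rewrite /= fineE; exact: Hn.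
Qed.

Lemma cvg_in_distribution_tight (R : realType) (d : nat -> measure_display)
    (T : forall n, measurableType (d n)) (P : forall n, probability (T n) R)
    (Y : forall n, {RV P n >-> R}) (d' : measure_display)
    (T' : measurableType d') (P' : probability T' R) (Z : {RV P' >-> R}) :
  cvg_in_distribution P Y P' Z ->
  forall e : R, 0 < e -> exists2 K : R, 0 < K &
    exists n0 : nat, forall n, (n0 <= n)%N -> pr (P n) (Y n @^-1` far K) <= e.
Proof.
move=> /cvg_in_distribution_Rintegral YZ e e0.
have e2 : 0 < e / 2 by rewrite divr_gt0.
have [m /(_ m (leqnn m)) Zm] := pr_far_small Z e2.
pose g (x : R) := (`| `|x| - m%:R| - `| `|x| - m%:R - 1| + 1) / 2.
have g01 x : 0 <= g x <= 1.
  rewrite /g; case: (ger0P (`|x| - m%:R)); case: (ger0P (`|x| - m%:R - 1)) => *;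
    lra.
have g0 x : `|x| <= m%:R -> g x = 0.
  by rewrite /g; case: (ger0P (`|x| - m%:R)); case: (ger0P (`|x| - m%:R - 1)) =>
    *; lra.
have g1 x : m%:R + 1 <= `|x| -> g x = 1.
  by rewrite /g; case: (ger0P (`|x| - m%:R)); case: (ger0P (`|x| - m%:R - 1)) =>
    *; lra.
have cg : continuous g.
  move=> x; apply: cvgM; last exact: cvg_cst.
  apply: cvgD; last exact: cvg_cst.
  have cu : `|y| - m%:R @[y --> x] --> `|x| - m%:R.
    by apply: cvgB; [apply: cvg_norm|exact: cvg_cst].
  apply: cvgB; first exact: cvg_norm.
  by apply: cvg_norm; apply: cvgB => //; exact: cvg_cst.
have gb x : `|g x| <= 1 by have /andP[h1 h2] := g01 x; rewrite ger0_norm.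
have mg d1 (T1 : measurableType d1) (V : {mfun T1 >-> R}) :
    measurable_fun setT (g \o V).
  apply: measurableT_comp; last exact: measurable_funPT.
  exact: continuous_measurable_fun.
have b0 (T1 : Type) (w : T1) : `|(fun=> 0 : R) w| <= 1 by rewrite normr0.
have mF d1 (T1 : measurableType d1) (V : {mfun T1 >-> R}) c :
    measurable (V @^-1` far c).
  by apply: measurable_mfun_preimage; exact: measurable_far.
have I0 d1 (T1 : measurableType d1) (Q : probability T1 R) :
    \int[Q]_w (0 : R) = 0 by rewrite Rintegral_cst// mul0r.
exists (m%:R + 1); first by rewrite ltr_wpDl.
have [n0 Hn] := YZ g 1 cg gb _ e2.
exists n0 => n /Hn {}Hn.
have hZ : \int[P' ]_w g (Z w) <= pr P' (Z @^-1` far m%:R).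
  have := @Rintegral_le_indic _ _ _ P' (g \o Z) (fun=>
    0) 1 0 1 (Z @^-1` far m%:R)
    (mg _ _ Z) (measurable_cst _) (fun w => gb (Z w)) (b0 _) (mF _ _ Z _).
  rewrite I0 mul1r !add0r; apply => w /=; rewrite indicE.
  case: (boolP (w \in _)) => [_|].
    by rewrite mulr1; have /andP[] := g01 (Z w); lra.
  by move=> /negP; rewrite mulr0 inE /far/= => /negP; rewrite -leNgt => /g0 ->;
    lra.
have hY : pr (P n) (Y n @^-1` far (m%:R + 1)) <= \int[P n]_w g (Y n w).
  have := @Rintegral_le_indic _ _ _ (P n) (fun=> 0) (g \o Y n) 1 0 (-1)
    (Y n @^-1` far (m%:R + 1)) (measurable_cst _) (mg _ _ (Y n))  (b0 _)
    (fun w => gb (Y n w)) (mF _ _ (Y n) _).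
  rewrite I0 addr0 => /(_ _)/wrap[]; last by rewrite /=; lra.
  move=> w /=; rewrite indicE.
  case: (boolP (w \in _)) => [|_].
    by rewrite mulr1 inE /far/= => /ltW /g1 ->; lra.
  by rewrite mulr0; have /andP[] := g01 (Y n w); lra.
move: Hn; rewrite ler_norml; lra.
Qed.

Lemma cvg_in_distribution_close (R : realType) (d : nat -> measure_display)
    (T : forall n, measurableType (d n)) (P : forall n, probability (T n) R)
    (X Y : forall n, {RV P n >-> R}) (d' : measure_display)
    (T' : measurableType d') (P' : probability T' R) (Z : {RV P' >-> R}) :
  (forall eta e : R, 0 < eta -> 0 < e -> exists n0 : nat, forall n, (n0 <=
    n)%N ->
     pr (P n) [set w | eta < `|Y n w - X n w|] <= e) ->
  cvg_in_distribution P Y P' Z -> cvg_in_distribution P X P' Z.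
Proof.
move=> XY YZ; apply/cvg_in_distribution_Rintegral => f M cf fM e e0.
have M0 : 0 <= M by apply: le_trans (fM 0).
pose e1 := e / (16 * (M + 1)).
have e10 : 0 < e1 by rewrite divr_gt0//; lra.
have Me1 : 4 * M * e1 <= e / 4.
  have : 16 * (M + 1) * e1 = e by rewrite /e1 mulrC divfK// gt_eqF//; lra.
  nra.
have e4 : 0 < e / 4 by rewrite divr_gt0.
have [K K0 [n1 Hn1]] := cvg_in_distribution_tight YZ e10.
have [eta eta0 Heta] := continuous_unif_segment K cf e4.
have [n2 Hn2] := XY _ _ eta0 e10.
have [n3 Hn3] := (iffLR (cvg_in_distribution_Rintegral _ _)) YZ f M cf fM _ e4.
exists (maxn n1 (maxn n2 n3)) => n; rewrite !geq_max =>
  /and3P[/Hn1 h1 /Hn2 h2 /Hn3 h3].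
pose B := (Y n @^-1` far K) `|` [set w | eta < `|Y n w - X n w|].
have mB1 : measurable (Y n @^-1` far K).
  by apply: measurable_mfun_preimage; exact: measurable_far.
have mB2 : measurable [set w | eta < `|Y n w - X n w|].
  have mYX : measurable_fun setT (Y n \- X n).
    by apply: measurable_funB; exact: measurable_funPT.
  by have := mYX measurableT _ (measurable_far eta); rewrite setTI.
have mB : measurable B by exact: measurableU.
have pB : pr (P n) B <= 2 * e1.
  by have := pr_setU_le (P n) mB1 mB2; rewrite -/B; lra.
have mcomp (V : {mfun T n >-> R}) : measurable_fun setT (f \o V).
  apply: measurableT_comp; last exact: measurable_funPT.
  exact: continuous_measurable_fun.
have diff w : `|f (Y n w) - f (X n w)| <= e / 4 + 2 * M * \1_B w.
  rewrite indicE; case: (boolP (w \in B)) => [_|].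
    have := ler_normB (f (Y n w)) (f (X n w)).
    by have := fM (Y n w); have := fM (X n w); rewrite mulr1; lra.
  move=> /negP; rewrite inE => nB; rewrite mulr0 addr0; apply: Heta.
    by rewrite leNgt; apply/negP => h; apply: nB; left.
  by rewrite leNgt; apply/negP => h; apply: nB; right.
have le1 := @Rintegral_le_indic _ _ _ (P n) (f \o X n) (f \o Y n) M (e / 4) (2 *
  M) B
  (mcomp (X n)) (mcomp (Y n)) (fun w => fM (X n w)) (fun w => fM (Y n w)) mB.
have le2 := @Rintegral_le_indic _ _ _ (P n) (f \o Y n) (f \o X n) M (e / 4) (2 *
  M) B
  (mcomp (Y n)) (mcomp (X n)) (fun w => fM (Y n w)) (fun w => fM (X n w)) mB.
have {}le1 : \int[P n]_w f (X n w) <= \int[P n]_w f (Y n w) + e / 4 + 2 * M * pr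
  (P n) B.
  by apply: le1 => w /=; have := diff w; rewrite ler_norml; lra.
have {}le2 : \int[P n]_w f (Y n w) <= \int[P n]_w f (X n w) + e / 4 + 2 * M * pr
  (P n) B.
  by apply: le2 => w /=; have := diff w; rewrite ler_norml; lra.
have MB : 2 * M * pr (P n) B <= 4 * M * e1 by nra.
move: h3; rewrite !ler_norml; lra.
Qed.

(** * Random times close to 1 *)

Lemma exists_doubling (R : realDomainType) (Q : R -> Prop) (a : R) (j : nat) :
  0 <= a -> ~ Q a -> Q (2 ^+ j * a) -> exists2 c, a <= c & ~ Q c /\ Q (2 * c).
Proof.
move=> a0 nQ; elim: j => [|j IH]; first by rewrite expr0 mul1r => /nQ.
case: (pselect (Q (2 ^+ j * a))) => [/IH//|nQj Qj].
exists (2 ^+ j * a); first by rewrite ler_peMl// exprn_ege1// ler1n.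
by split => //; rewrite mulrA -exprS.
Qed.

Lemma measurable_time_far (R : realType) (d : measure_display)
    (T : measurableType d) (P : probability T R) (tau : random_time P) (e : R) :
  measurable [set w | e <= `|tau w - 1|].
Proof.
have mt : measurable_fun setT (fun w => `|tau w - 1|).
  apply: measurableT_comp; first exact: normr_measurable.
  by apply: measurable_funB; [exact: measurable_funPT|exact: measurable_cst].
have := mt measurableT _ (measurable_itv `[e, +oo[).
by rewrite setTI; congr measurable; apply/seteqP; split => w /=;
  rewrite in_itv/= andbT.
Qed.

(* If the conclusion fails, doubling [4 K] yields a scale [c >= 4 K] exceeded with
   probability more than 1/8 while [2 c] is not; the oscillation bound at scale
   [2 c] contradicts this. *)
Lemma base_point_tight (R : realType) : exists2 delta : R, 0 < delta < 1 &
  forall (d : measure_display) (T : measurableType d) (P : probability T R)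
    (X : levy_process P) (tau : random_time P) (K : R), 0 < K ->
    pr P [set w | delta <= `|tau w - 1|] <= 32^-1 ->
    pr P (sample X tau @^-1` far K) <= 32^-1 ->
    pr P (X (1 - delta) @^-1` far (4 * K)) <= 8^-1.
Proof.
have [||tau0 tau00 osc] := @local_oscillation R 8^-1 32^-1; [lra|lra|].
pose delta := Num.min 2^-1 (tau0 / 8).
have [d0 d2 d8] : [/\ 0 < delta, delta <= 2^-1 & delta <= tau0 / 8].
  by split; rewrite ?lt_min ?ge_min ?lexx ?orbT// !divr_gt0//; lra.
exists delta; first lra.
move=> d T P X tau K K0 Htau HK; set u := 1 - delta.
apply: contrapT => HX.
have K4 : 0 < 4 * K by rewrite mulr_gt0.
have i8 : 0 < 8^-1 :> R by lra.
have [n Hn] := @pr_far_small _ _ _ P (X u) _ i8.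
have mfar (V : {mfun T >-> R}) c : measurable (V @^-1` far c).
  by apply: measurable_mfun_preimage; exact: measurable_far.
pose Q c := pr P (X u @^-1` far c) <= 8^-1.
have [c cK [Qc Q2c]] : exists2 c, 4 * K <= c & ~ Q c /\ Q (2 * c).
  pose j := maxn n (Num.trunc (n%:R / (4 * K))).+1.
  apply: (@exists_doubling _ Q _ j) => //; first exact: ltW.
  apply: le_trans (Hn n (leqnn n)); apply: pr_le => // w; rewrite /far/=.
  apply: le_lt_trans; rewrite -ler_pdivrMr//.
  apply: (@le_trans _ _ j%:R).
    apply: (@le_trans _ _ (Num.trunc (n%:R / (4 * K))).+1%:R).
      by rewrite ltW// truncnS_gt.
    by rewrite ler_nat leq_maxr.
  by rewrite -natrX ler_nat ltnW// ltn_expl.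
have c0 : 0 < c by lra.
have [||||A [mA pA HA]] := osc d T P X u (2 * c) u => //; rewrite ?/u; try lra.
apply: Qc; rewrite /Q.
pose B := [set w | delta <= `|tau w - 1|].
have mB : measurable B by exact: measurable_time_far.
apply: (@le_trans _ _ (pr P ((A `|` B) `|` (sample X tau @^-1` far K))));
  last first.
  have := pr_setU_le P (measurableU _ _ mA mB) (mfar (sample X tau) K).
  have := pr_setU_le P mA mB; rewrite -/B in Htau; lra.
apply: pr_le => //; first by apply: measurableU => //; exact: measurableU.
move=> w Xw; apply: contrapT => /not_orP[/not_orP[nA nB] nK].
have tauw : `|tau w - 1| < delta by rewrite ltNge; apply/negP.
have sw : `|X (tau w) w| <= K by rewrite leNgt; apply/negP.
have inc : `|X (tau w) w - X u w| <= 8^-1 * (2 * c).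
  rewrite leNgt; apply/negP => h; apply: nA; apply: (HA w (tau w)) => //.
  by move: tauw; rewrite ltr_norml /u => ?; apply/andP; split; nra.
move: Xw; rewrite /far/=.
have := ler_normB (X (tau w) w) (X (tau w) w - X u w).
have -> : X (tau w) w - (X (tau w) w - X u w) = X u w by lra.
lra.
Qed.

Lemma sample_near_one (R : realType) (delta K eta p : R) :
  0 < delta < 1 -> 0 < K -> 0 < eta -> 0 < p < 1 ->
  exists2 delta' : R, 0 < delta' &
  forall (d : measure_display) (T : measurableType d) (P : probability T R)
    (X : levy_process P) (tau : random_time P),
    pr P (X (1 - delta) @^-1` far K) <= 8^-1 ->
    pr P [set w | delta' <= `|tau w - 1|] <= p ->
    pr P [set w | eta < `|sample X tau w - X 1 w|] <= 2 * p.
Proof.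
move=> d01 K0 eta0 p01.
have eta1 : 0 < eta / 2 / K by rewrite !divr_gt0.
have [tau0 tau00 osc] := local_oscillation eta1 p01.
set u := 1 - delta; have u0 : 0 < u by rewrite /u; lra.
pose delta' := Num.min 2^-1 (tau0 * u / 4).
have [d0 d2 d8] : [/\ 0 < delta', delta' <= 2^-1 & delta' <= tau0 * u / 4].
  by split; rewrite ?lt_min ?ge_min ?lexx ?orbT// divr_gt0//;
    [lra|rewrite mulr_gt0].
exists delta' => // d T P X tau HX Htau; pose v := 1 - delta'.
have v0 : 0 <= v by rewrite /v; lra.
have [A [mA pA HA]] := osc d T P X u K v u0 K0 v0 HX.
pose B := [set w | delta' <= `|tau w - 1|].
have mB : measurable B by exact: measurable_time_far.
apply: (@le_trans _ _ (pr P (A `|` B))); last first.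
  by have := pr_setU_le P mA mB; rewrite -/B in Htau; lra.
apply: pr_le; last 1 first.
- move=> w Xw; apply: contrapT => /not_orP[nA nB].
  have tauw : `|tau w - 1| < delta' by rewrite ltNge; apply/negP.
  have E : eta / 2 / K * K = eta / 2 by rewrite divfK// gt_eqF.
  have inc s : `|s - 1| < delta' -> `|X s w - X v w| <= eta / 2.
    rewrite ltr_norml => h; rewrite -E leNgt; apply/negP => h'; apply: nA.
    by apply: (HA w s) => //; rewrite /v; lra.
  have := inc _ tauw; have := inc 1; rewrite subrr normr0 => /(_ d0).
  move: Xw; rewrite /sample/=.
  have := ler_normB (X (tau w) w - X v w) (X 1 w - X v w).
  have -> : X (tau w) w - X v w - (X 1 w - X v w) = X (tau w) w - X 1 w by lra.
  lra.
- have mYX : measurable_fun setT (sample X tau \- X 1).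
    by apply: measurable_funB; exact: measurable_funPT.
  by have := mYX measurableT _ (measurable_far eta); rewrite setTI.
- exact: measurableU.
Qed.

Theorem proposition12 (R : realType) (d : nat -> measure_display)
    (Omega : forall n, measurableType (d n))
    (P : forall n, probability (Omega n) R)
    (xi : forall n, levy_process (P n))
    (T : forall n, random_time (P n))
    (d0 : measure_display) (Omega0 : measurableType d0)
    (P0 : probability Omega0 R) (Z : {RV P0 >-> R}) :
  cvg_in_probability_cst P (fun n => T n) 1 ->
  cvg_in_distribution P (fun n => sample (xi n) (T n)) P0 Z ->
  cvg_in_distribution P (fun n => xi n 1) P0 Z.
Proof.
move=> T1 YZ; apply: cvg_in_distribution_close (YZ) => eta e eta0 e0.
have T1' (delta p : R) : 0 < delta -> 0 < p ->
  exists n0 : nat, forall n, (n0 <= n)%N ->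
    pr (P n) [set w | delta <= `|T n w - 1|] <= p.
  move=> delta0 p0; have := T1 _ delta0.
  move=> /fine_cvgP[_ /cvgrPdist_le/(_ _ p0)[n0 _ Hn]].
  exists n0 => n nn; have := Hn n nn; rewrite /= sub0r normrN; apply: le_trans.
  exact: ler_norm.
have i32 : 0 < 32^-1 :> R by lra.
have [delta d01 Hdelta] := base_point_tight R.
have [K K0 [n1 Hn1]] := cvg_in_distribution_tight YZ i32.
have delta0 : 0 < delta by lra.
have [n2 Hn2] := T1' _ _ delta0 i32.
pose p := Num.min (e / 2) 2^-1.
have [p0 pe p2] : [/\ 0 < p, p <= e / 2 & p <= 2^-1].
  by split; rewrite ?lt_min ?ge_min ?lexx ?orbT// divr_gt0//; lra.
have p01 : 0 < p < 1 by lra.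
have K4 : 0 < 4 * K by rewrite mulr_gt0.
have [delta' d'0 Hdelta'] := sample_near_one d01 K4 eta0 p01.
have [n3 Hn3] := T1' _ _ d'0 p0.
exists (maxn n1 (maxn n2 n3)) => n; rewrite !geq_max => /and3P[h1 h2 h3].
apply: (@le_trans _ _ (2 * p)); last lra.
by apply: Hdelta'; [apply: Hdelta => //; [exact: Hn2|exact: Hn1]|exact: Hn3].
Qed.
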